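(* Let $\mathcal{B}\subset\mathcal{E}$ be the union of the set $\mathcal{D}$ of Dyck paths with the set $\mathcal{D}''$ of paths in $\mathcal{E}$ having exactly one catastrophe (at any position). The ordinary generating function $B(x)=\sum_{P\in\mathcal{B}}x^{|P|}$ of $\mathcal{B}$ with respect to the length is $$B(x)=\frac{\left(1-\sqrt{1-4x^2}\right)\left(2x^3-4x^2+1+(2x^2-1)\sqrt{1-4x^2}\right)}{2x^4\left(2x-1+\sqrt{1-4x^2}\right)},$$ and its series expansion is $$1+x^2+x^3+3x^4+5x^5+11x^6+21x^7+42x^8+84x^9+162x^{10}+330x^{11}+O(x^{12}).$$
   Context: A Dyck path with catastrophes is a finite lattice path in the first quadrant ($y\ge 0$) starting at the origin, ending on the $x$-axis, with steps $U=(1,1)$, $D=(1,-1)$ and catastrophe steps $C_k=(1,-k)$, $k\ge 2$, where a catastrophe step must end on the $x$-axis (so $C_k$ can only be used from height $k$). $\mathcal{E}$ is the set of all Dyck paths with catastrophes (including the empty path), and $\mathcal{D}\subset\mathcal{E}$ is the set of Dyck paths, i.e. paths without catastrophe steps. The length $|P|$ is the number of steps of $P$. Generating functions are formal power series in $x$, and $\sqrt{1-4x^2}$ is the power series square root with constant term $1$. *)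

(* Defs.v *)
From HB Require Import structures.
From mathcomp Require Import all_boot all_order all_algebra finmap.
From mathcomp Require Import all_classical.

Set Implicit Arguments.
Unset Strict Implicit.
Unset Printing Implicit Defensive.

Import Order.TTheory GRing.Theory Num.Theory.
Local Open Scope classical_set_scope.
Local Open Scope ring_scope.

(* A record rather than a bare [nat -> F], on which the library already puts
   the pointwise ring structure. *)
Record fps (F : Type) := FPS { fps_coef : nat -> F }.
Notation "f ``_ n" := (fps_coef f n)
  (at level 3, n at level 2, left associativity, format "f ``_ n") : ring_scope.

Notation "x %:F" := (FracField.tofrac x) : ring_scope.

Section FpsRing.
Variable F : fieldType.
Implicit Types f g h : fps F.

Lemma fps_coefK : cancel (@fps_coef F) (@FPS F).
Proof. by case. Qed.

HB.instance Definition _ := Choice.copy (fps F) (can_type fps_coefK).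

Lemma fpsP f g : (forall n, f``_n = g``_n) -> f = g.
Proof. by move=> fg; apply: (can_inj fps_coefK); apply/funext. Qed.

Definition fps_const (a : F) := FPS (fun n => if n == 0%N then a else 0).
Definition fpsX : fps F := FPS (fun n => (n == 1%N)%:R).
Definition fps_add f g := FPS (fun n => f``_n + g``_n).
Definition fps_opp f := FPS (fun n => - f``_n).
Definition fps_mul f g := FPS (fun n => \sum_(i < n.+1) f``_i * g``_(n - i)).

Lemma fps_addA : associative fps_add.
Proof. by move=> f g h; apply: fpsP => n /=; rewrite addrA. Qed.
Lemma fps_addC : commutative fps_add.
Proof. by move=> f g; apply: fpsP => n /=; rewrite addrC. Qed.
Lemma fps_add0 : left_id (fps_const 0) fps_add.
Proof. by move=> f; apply: fpsP => n /=; rewrite if_same add0r. Qed.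
Lemma fps_addN : left_inverse (fps_const 0) fps_opp fps_add.
Proof. by move=> f; apply: fpsP => n /=; rewrite if_same addNr. Qed.

HB.instance Definition _ :=
  GRing.isZmodule.Build (fps F) fps_addA fps_addC fps_add0 fps_addN.

Definition fps_trunc N f : {poly F} := \poly_(i < N) f``_i.

Lemma coef_fps_mul N f g n : (n < N)%N ->
  (fps_mul f g)``_n = (fps_trunc N f * fps_trunc N g)`_n.
Proof.
move=> nN; rewrite coefM; apply: eq_bigr => i _; rewrite !coef_poly.
by rewrite (leq_ltn_trans _ nN) ?leq_ord// (leq_ltn_trans _ nN) ?leq_subr.
Qed.

Lemma fps_mulA : associative fps_mul.
Proof.
move=> f g h; apply: fpsP => n.
transitivity ((fps_trunc n.+1 f * (fps_trunc n.+1 g * fps_trunc n.+1 h))`_n).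
  rewrite coefM; apply: eq_bigr => i _; rewrite coef_poly ltn_ord.
  by rewrite (@coef_fps_mul n.+1) // ltnS leq_subr.
rewrite mulrA coefM; apply: eq_bigr => i _.
by rewrite coef_poly ltnS leq_subr (@coef_fps_mul n.+1).
Qed.
Lemma fps_mulC : commutative fps_mul.
Proof.
by move=> f g; apply: fpsP => n; rewrite !(@coef_fps_mul n.+1) // mulrC.
Qed.
Lemma fps_mul1 : left_id (fps_const 1) fps_mul.
Proof.
move=> f; apply: fpsP => n; rewrite /= big_ord_recl /= mul1r subn0.
by rewrite big1 ?addr0 // => i _; rewrite mul0r.
Qed.
Lemma fps_mulDl : left_distributive fps_mul fps_add.
Proof.
move=> f g h; apply: fpsP => n /=; rewrite -big_split /=.
by apply: eq_bigr => i _; rewrite mulrDl.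
Qed.
Lemma fps_1neq0 : fps_const 1 != 0.
Proof. by apply/eqP => /(congr1 (fun f => f``_0)) /eqP; rewrite oner_eq0. Qed.

HB.instance Definition _ := GRing.Zmodule_isComNzRing.Build (fps F)
  fps_mulA fps_mulC fps_mul1 fps_mulDl fps_1neq0.

Lemma coef_fpsM f g n : (f * g)``_n = \sum_(i < n.+1) f``_i * g``_(n - i).
Proof. by []. Qed.
Lemma coef_fpsD f g n : (f + g)``_n = f``_n + g``_n.
Proof. by []. Qed.
Lemma coef_fpsN f n : (- f)``_n = - f``_n.
Proof. by []. Qed.
Lemma coef_fps0 n : (0 : fps F)``_n = 0.
Proof. by rewrite /= if_same. Qed.
Lemma coef_fps1 n : (1 : fps F)``_n = (n == 0%N)%:R.
Proof. by rewrite /=; case: eqP. Qed.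

Definition fps_unit : pred (fps F) := fun f => `[< exists g, g * f = 1 >].
Definition fps_inv f :=
  if pselect (exists g, g * f = 1) is left e then projT1 (cid e) else f.

Lemma fps_mulVr : {in fps_unit, left_inverse 1 fps_inv *%R}.
Proof.
move=> f /asboolP uf; rewrite /fps_inv; case: pselect => // e.
by case: cid.
Qed.
Lemma fps_unitPl f g : g * f = 1 -> fps_unit f.
Proof. by move=> gf; apply/asboolP; exists g. Qed.
Lemma fps_inv_out : {in [predC fps_unit], fps_inv =1 id}.
Proof.
move=> f; rewrite inE /= => /asboolPn nuf.
by rewrite /fps_inv; case: pselect.
Qed.

HB.instance Definition _ := GRing.ComNzRing_hasMulInverse.Build (fps F)
  fps_mulVr fps_unitPl fps_inv_out.

Lemma fps_lead f : f != 0 ->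
  exists m, f``_m != 0 /\ forall i, (i < m)%N -> f``_i = 0.
Proof.
move=> nz; have ex : exists m, f``_m != 0.
  apply: contrapT => nex; case/eqP: nz; apply: fpsP => n; rewrite coef_fps0.
  by apply/eqP; apply: contrapT => /negP ?; apply: nex; exists n.
case: (ex_minnP ex) => m fm mmin; exists m; split=> // i im.
by apply/eqP; apply: contraTT im => /mmin; rewrite leqNgt.
Qed.

Lemma fps_idomain : GRing.integral_domain_axiom (fps F).
Proof.
move=> f g fg0; apply: contraT; rewrite negb_or => /andP[].
case/fps_lead=> m [fm fm0] /fps_lead[k [gk gk0]].
have := congr1 (@fps_coef F ^~ (m + k)%N) fg0; rewrite coef_fps0 coef_fpsM.
have mk : (m < (m + k).+1)%N by rewrite ltnS leq_addr.
rewrite (bigD1 (Ordinal mk)) //= addKn big1 ?addr0.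
  by move/eqP; rewrite mulf_eq0 (negbTE fm) (negbTE gk).
move=> i; rewrite -val_eqE /= neq_ltn => /orP[im|mi].
  by rewrite fm0 // mul0r.
rewrite gk0 ?mulr0 // ltn_subLR ?ltn_add2r //.
by rewrite -ltnS.
Qed.

HB.instance Definition _ :=
  GRing.ComUnitRing_isIntegral.Build (fps F) fps_idomain.

(* The coefficients s_n of the square root with constant term 1 of a series
   f with constant term 1 are read off from
     f_n = 2 s_n + \sum_(1 <= i < n) s_i s_(n-i)   for n > 0. *)
Fixpoint fps_sqrt_seq f n : seq F :=
  if n is m.+1 then
    let s := fps_sqrt_seq f m in
    rcons s (if m == 0%N then 1
             else (f``_m - \sum_(1 <= i < m) s`_i * s`_(m - i)) / 2)
  else [::].

Definition fps_sqrt f := FPS (fun n => (fps_sqrt_seq f n.+1)`_n).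

Lemma fps_sqrt_seqS f n : fps_sqrt_seq f n.+1 = rcons (fps_sqrt_seq f n)
  (if n == 0%N then 1 else
   (f``_n - \sum_(1 <= i < n) (fps_sqrt_seq f n)`_i *
     (fps_sqrt_seq f n)`_(n - i)) / 2).
Proof. by []. Qed.

Lemma size_fps_sqrt_seq f n : size (fps_sqrt_seq f n) = n.
Proof. by elim: n => //= n IHn; rewrite size_rcons IHn. Qed.

Lemma nth_fps_sqrt_seq f n i : (i < n)%N ->
  (fps_sqrt_seq f n)`_i = (fps_sqrt f)``_i.
Proof.
elim: n => // n IHn; rewrite ltnS leq_eqVlt => /orP[/eqP->//|lin].
by rewrite /= nth_rcons size_fps_sqrt_seq lin IHn.
Qed.

Lemma fps_sqrt0 f : (fps_sqrt f)``_0 = 1.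
Proof. by []. Qed.

Lemma fps_sqrtS f n : (fps_sqrt f)``_n.+1 = (f``_n.+1 -
  \sum_(1 <= i < n.+1) (fps_sqrt f)``_i * (fps_sqrt f)``_(n.+1 - i)) / 2.
Proof.
rewrite [LHS]/fps_coef /fps_sqrt fps_sqrt_seqS.
rewrite nth_rcons size_fps_sqrt_seq ltnn eqxx; congr ((_ - _) / _).
apply: eq_big_nat => i /andP[i0 iN]; rewrite !nth_fps_sqrt_seq //.
by rewrite ltn_subLR ?(ltnW iN)// -[X in (X < _)%N]add0n ltn_add2r.
Qed.

Lemma fps_sqrtK f : 2 != 0 :> F -> f``_0 = 1 -> fps_sqrt f ^+ 2 = f.
Proof.
move=> nz2 f0; have := fps_sqrtS f; have := fps_sqrt0 f.
move: (fps_sqrt f) => s s0 sS; apply: fpsP => -[|n].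
  by rewrite expr2 coef_fpsM big_ord1 s0 f0 mulr1.
rewrite expr2 coef_fpsM big_ord_recl big_ord_recr /= subn0 subnn s0.
rewrite sS big_add1 /= big_mkord.
set S := \sum_(i < n) _; set a := (_ - S) / 2.
by rewrite mul1r mulr1 addrCA -mulr2n -mulr_natr divfK // addrC subrK.
Qed.

Lemma fps_sqrt_uniq f s : 2 != 0 :> F ->
  s ^+ 2 = f -> s``_0 = 1 -> s = fps_sqrt f.
Proof.
move=> nz2 sf s0.
have f0 : f``_0 = 1 by rewrite -sf expr2 coef_fpsM big_ord1 s0 mulr1.
have /eqP := etrans sf (esym (fps_sqrtK nz2 f0)).
rewrite eqf_sqr => /orP[/eqP//|/eqP/(congr1 (fun h => h``_0))].
rewrite coef_fpsN fps_sqrt0 s0 => /eqP; rewrite -addr_eq0 -mulr2n.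
by rewrite (negbTE nz2).
Qed.

(* f = g + O(x^n) *)
Definition fps_eqO n f g := forall i, (i < n)%N -> f``_i = g``_i.

End FpsRing.

(* Only meaningful when every [A `&` [set t | size t = n]] is finite:
   [fset_set] is empty on infinite sets. *)
Definition ogf (T : choiceType) (size : T -> nat) (A : set T) : fps rat :=
  FPS (fun n => (#|` fset_set (A `&` [set t | size t = n])|)%:R).

Inductive step := U | D | C of nat.

Definition step_code s : option (option nat) :=
  match s with U => None | D => Some None | C k => Some (Some k) end.
Definition step_decode c :=
  match c with None => U | Some None => D | Some (Some k) => C k end.
Lemma step_codeK : cancel step_code step_decode.
Proof. by case. Qed.
HB.instance Definition _ := Countable.copy step (can_type step_codeK).

Definition rise (s : step) : int :=
  match s with U => 1 | D => -1 | C k => - k%:Z end.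
Definition is_catastrophe (s : step) : bool := if s is C _ then true else false.

Definition height (P : seq step) : int := \sum_(s <- P) rise s.

Definition pathE : set (seq step) := [set P |
  [/\ forall Q R, P = Q ++ R -> 0 <= height Q,
      height P = 0 &
      forall Q R k, P = rcons Q (C k) ++ R ->
        (2 <= k)%N /\ height (rcons Q (C k)) = 0]].

Definition pathD : set (seq step) :=
  pathE `&` [set P | ~~ has is_catastrophe P].

Definition pathD'' : set (seq step) :=
  pathE `&` [set P | count is_catastrophe P = 1%N].

Definition pathB : set (seq step) := pathD `|` pathD''.

Lemma height_le_size P : height P <= (size P)%:Z.
Proof.
rewrite /height; elim: P => [|s P IHP]; first by rewrite big_nil.
rewrite big_cons /= -add1n PoszD lerD // {IHP}.
by case: s => //= k; rewrite (@le_trans _ _ 0) // oppr_le0.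
Qed.

Lemma pathE_C_le P k : pathE P -> C k \in P -> (k <= size P)%N.
Proof.
case=> _ _ catP /path.splitPr defP; case: defP catP => Q R catP.
have [|_] := catP Q R k; first by rewrite cat_rcons.
rewrite /height -cats1 big_cat big_seq1 /= => /eqP; rewrite subr_eq0 => /eqP hQ.
rewrite size_cat -lez_nat -hQ (le_trans (height_le_size Q)) // lez_nat.
exact: leq_addr.
Qed.

Lemma pathE_finite n : finite_set (pathE `&` [set P | size P = n]).
Proof.
pose h (t : n.-tuple (option (option 'I_n.+1))) : seq step :=
  [seq step_decode (omap (omap val) c) | c <- t].
apply: (@sub_finite_set _ _ (h @` setT)); last first.
  exact/finite_image/finite_finset.
move=> P [EP /= sP].
pose r s : option (option 'I_n.+1) :=
  omap (omap (@inord n)) (step_code s).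
have sr : size (map r P) == n by rewrite size_map sP.
exists (Tuple sr) => //; rewrite /h /= -map_comp -[RHS]map_id.
apply/eq_in_map => -[||k] //= kP.
by rewrite inordK // ltnS -sP; exact: pathE_C_le.
Qed.

(* Main.v *)
(* Let gf c h count by length the nonnegative paths from height h to height 0
   with exactly c catastrophes. Splitting off the first step gives the linear
   system
     gf c h = [boundary term] + x (gf c (h+1) + gf c (h-1)),
   which determines all coefficients, so closed forms need only be checked
   against it. With d the Dyck series, d = 1 + x^2 d^2, one has
     gf 0 h = x^h d^(h+1)
     (1 - 2x) gf 1 h = x d - d^2 (1 - x - x^2) (x d)^h + [h = 0] (1 - 2x) d,
   and B = gf 0 0 + gf 1 0; finally sqrt(1 - 4x^2) = 1 - 2 x^2 d. *)
Require Import Defs.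
From mathcomp Require Import all_boot all_order all_algebra.
From mathcomp Require Import finmap all_classical ring zify.

Set Implicit Arguments.
Unset Strict Implicit.
Unset Printing Implicit Defensive.

Import Order.TTheory GRing.Theory Num.Theory.

Local Open Scope ring_scope.

(** * Enumeration of paths by their first step *)

(** Among catastrophes only [C h] can be taken from height [h]. Being computable, these lists also
    yield the numerical coefficients. *)
Fixpoint paths (n c h : nat) : seq (seq step) :=
  if n isn't m.+1 then if (h == 0%N) && (c == 0%N) then [:: [::]] else [::]
  else map (cons U) (paths m c h.+1)
    ++ (if h is h'.+1 then map (cons D) (paths m c h') else [::])
    ++ (if c is c'.+1 then
          if (1 < h)%N then map (cons (C h)) (paths m c' 0) else [::]
        else [::]).

Lemma mem_map_cons (T : eqType) (a b : T) s (r : seq (seq T)) :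
  (a :: s \in map (cons b) r) = (a == b) && (s \in r).
Proof.
apply/mapP/andP => [[t tr [-> ->]] | [/eqP-> sr]]; first by rewrite eqxx.
by exists s.
Qed.

Lemma nil_map_cons (T : eqType) (b : T) (r : seq (seq T)) :
  ([::] \in map (cons b) r) = false.
Proof. by apply/negbTE/mapP => -[]. Qed.

(** The three blocks are disjoint because their paths start with different steps. *)
Lemma uniq_paths n c h : uniq (paths n c h).
Proof.
have cons_inj (a : step) : injective (cons a) by move=> ? ? [].
elim: n c h => [|n IHn] c h /=; first by case: ifP.
rewrite !cat_uniq map_inj_uniq // IHn /=; apply/and3P; split.
- apply/hasPn => P; rewrite mem_cat; apply: contraL => /mapP[Q _ ->].
  rewrite negb_or; apply/andP; split.
    by case: h => // h; rewrite mem_map_cons.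
  by case: c => // c; case: ifP => // _; rewrite mem_map_cons.
- by case: h => // h; rewrite map_inj_uniq.
apply/andP; split; last by case: c => // c; case: ifP; rewrite ?map_inj_uniq.
apply/hasPn => P; apply: contraL; case: h => // h /mapP[Q _ ->].
by case: c => // c; case: ifP => // _; rewrite mem_map_cons.
Qed.

(** [pathE] with an arbitrary starting height: a family closed under removing the first step, as
    induction requires. *)
Definition path_from (h : nat) (P : seq step) : Prop :=
  [/\ forall Q R, P = Q ++ R -> 0 <= h%:Z + height Q,
      h%:Z + height P = 0 &
      forall Q R k, P = rcons Q (C k) ++ R ->
        (2 <= k)%N /\ h%:Z + height (rcons Q (C k)) = 0].

Lemma height_nil : height [::] = 0.
Proof. by rewrite /height big_nil. Qed.

Lemma height_cons s P : height (s :: P) = rise s + height P.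
Proof. by rewrite /height big_cons. Qed.

Lemma pathEE P : pathE P <-> path_from 0 P.
Proof.
split=> -[P1 P2 P3]; split=> [Q R /P1||Q R k /P3]; rewrite ?add0r //.
  by move: P2; rewrite add0r.
Qed.

Lemma path_from_nil h : path_from h [::] <-> h = 0%N.
Proof.
split=> [[_ + _]|->]; first by rewrite height_nil addr0 => -[].
by split=> [[]//||[]//]; rewrite ?height_nil.
Qed.

Lemma path_from_cons h s P : path_from h (s :: P) <->
  exists h', [/\ h'%:Z = h%:Z + rise s, path_from h' P &
    forall k, s = C k -> (2 <= k)%N /\ h' = 0%N].
Proof.
split=> [[P1 P2 P3]|[h' [hh' [P1 P2 P3] Ps]]].
  have := P1 [:: s] P erefl; rewrite height_cons height_nil addr0.
  (* The prefix [[:: s]] rules out a negative height after the first step, so that height is a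
     natural number [h']. *)
  case hE: (h%:Z + rise s) => [h'|//] _; exists h'; split=> //.
    split=> [Q R PE||Q R k PE].
    - by rewrite -hE -addrA -height_cons (P1 _ R) ?PE.
    - by rewrite -hE -addrA -height_cons.
    by rewrite -hE -addrA -height_cons -rcons_cons; apply: (P3 _ R); rewrite PE.
  move=> k sk; have [] := P3 [::] P k; first by rewrite sk.
  by rewrite height_cons height_nil addr0 -sk hE => ? [].
split=> [[|t Q] R||[|t Q] R k].
- by rewrite height_nil addr0.
- by case=> <- PE; rewrite height_cons addrA -hh' (P1 _ R).
- by rewrite height_cons addrA -hh'.
- case=> sk _; have [k2 h0] := Ps _ sk.
  by rewrite height_cons height_nil addr0 -sk -hh' h0.
case=> <- PE; rewrite rcons_cons height_cons addrA -hh'; exact: (P3 _ R).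
Qed.

Lemma mem_paths n c h P : P \in paths n c h <->
  [/\ path_from h P, count is_catastrophe P = c & size P = n].
Proof.
elim: n c h P => [|n IHn] c h [|s P] /=.
- split; last by case=> /path_from_nil-> <-.
  by case: ifP => // /andP[/eqP-> /eqP->] _; split=> //; apply/path_from_nil.
- by split=> [|[]//]; case: ifP => // _; rewrite inE.
- split=> [|[]//]; rewrite !mem_cat nil_map_cons.
  by case: h => [|h]; case: c => [|c]; rewrite ?nil_map_cons //; case: ifP;
    rewrite ?nil_map_cons.
rewrite !mem_cat mem_map_cons; split.
  case/or3P.
  - case/andP=> /eqP-> /IHn[hP cP <-]; split=> //.
    by apply/path_from_cons; exists h.+1; split=> //=; lia.
  - case: h => // h; rewrite mem_map_cons => /andP[/eqP-> /IHn[hP cP <-]].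
    by split=> //; apply/path_from_cons; exists h; split=> //=; lia.
  case: c => // c; case: ifP => // h1.
  rewrite mem_map_cons => /andP[/eqP-> /IHn[hP <- <-]]; split=> //.
  apply/path_from_cons; exists 0%N; split=> //= [|k [<-]//]; lia.
case=> /path_from_cons[h' [hh' hP Ps]] cP [sP]; apply/or3P.
case: s hh' Ps cP => [||k] /= hh' Ps cP.
- constructor 1; rewrite /=; apply/IHn; split=> //.
  by have <- : h' = h.+1 by lia.
- constructor 2; have -> : h = h'.+1 by lia.
  by rewrite mem_map_cons ?eqxx /=; apply/IHn.
(* Landing on the axis forces [h = k], the only catastrophe that [paths] offers. *)
constructor 3; have [k2 h0] := Ps _ erefl; have hk : h = k by lia.
by rewrite -cP add1n hk k2 mem_map_cons ?eqxx /=; apply/IHn; rewrite -h0.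
Qed.

Definition gf (c h : nat) : fps rat := FPS (fun n => (size (paths n c h))%:R).

(** The two lists are disjoint, as their paths have 0 and 1 catastrophes; being duplicate-free, they
    turn cardinality into length. *)
Lemma ogf_pathB : ogf size pathB = gf 0 0 + gf 1 0.
Proof.
apply: fpsP => n; rewrite /ogf /= -natrD -size_cat; congr _%:R.
set s := _ ++ _.
have -> : (pathB `&` [set P | size P = n])%classic =
    [set` [fset P in s]%fset]%classic.
  apply/seteqP; split=> P /=; rewrite in_fset /= mem_cat.
    case=> -[] [/pathEE EP cP] sP; apply/orP; [left | right]; apply/mem_paths.
      by split=> //; move: cP => /=; rewrite has_count -eqn0Ngt => /eqP.
    by split.
  case/orP=> /mem_paths[/pathEE EP cP sP]; split=> //; [left | right] => //.
  by split=> //=; rewrite has_count cP.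
rewrite set_fsetK card_fseq undup_id // cat_uniq !uniq_paths /= andbT.
apply/hasPn => P /mem_paths[_ c1 _]; apply/negP => /mem_paths[_ + _].
by rewrite c1.
Qed.

(** * Multiplication by [x] and uniqueness for first-step recurrences *)

Section FpsX.
Variable F : fieldType.
Implicit Types f : fps F.
Local Notation x := (fpsX F).

Lemma coef_fpsXM0 f : (x * f)``_0 = 0.
Proof. by rewrite coef_fpsM big_ord1 mul0r. Qed.

Lemma coef_fpsXMS f n : (x * f)``_n.+1 = f``_n.
Proof.
rewrite coef_fpsM !big_ord_recl big1 /= => [|i _]; last by rewrite mul0r.
by rewrite mul0r add0r mul1r addr0 subn1.
Qed.

Lemma coef_fpsXn k n : (x ^+ k)``_n = (n == k)%:R.
Proof.
elim: k n => [|k IHk] [|n]; rewrite ?expr0 ?coef_fps1 ?exprS //.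
  exact: coef_fpsXM0.
by rewrite coef_fpsXMS IHk.
Qed.

Lemma coef_fpsMn f m n : (f *+ m)``_n = f``_n *+ m.
Proof.
by elim: m => [|m IHm]; rewrite ?mulr0n ?coef_fps0 // !mulrS coef_fpsD IHm.
Qed.

Lemma coef_fpsD_natMXn f m k n :
  (f + m%:R * x ^+ k)``_n = f``_n + (m * (n == k))%:R.
Proof.
by rewrite mulr_natl coef_fpsD coef_fpsMn coef_fpsXn mulnC natrM mulr_natr.
Qed.

Lemma fps_divXn f k : (forall i, (i < k)%N -> f``_i = 0) ->
  exists g, f = x ^+ k * g.
Proof.
elim: k f => [|k IHk] f f0; first by exists f; rewrite mul1r.
have [i ik|g gE] := IHk (FPS (fun n => f``_n.+1)); first exact: f0.
exists g; rewrite exprS -mulrA -gE; apply: fpsP => -[|n].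
  by rewrite coef_fpsXM0 f0.
by rewrite coef_fpsXMS.
Qed.

(** The factor [x] expresses coefficient n+1 at height [h] through coefficients n at the
    neighbouring heights, so induction on n, for all heights at once, applies. *)
Lemma first_step_eq_uniq (c A B : nat -> fps F) :
  (forall h, A h = c h + x * (A h.+1 + (if h is h'.+1 then A h' else 0))) ->
  (forall h, B h = c h + x * (B h.+1 + (if h is h'.+1 then B h' else 0))) ->
  A =1 B.
Proof.
move=> AE BE h; apply: fpsP => n; elim: n h => [|n IHn] h.
  by rewrite AE BE !coef_fpsD !coef_fpsXM0.
rewrite AE BE !(coef_fpsD (c h)) !coef_fpsXMS !coef_fpsD IHn.
by case: h => [|h]; rewrite ?IHn.
Qed.

End FpsX.

(** * Recurrences and closed forms *)

Section GeneratingFunctions.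
Local Notation x := (fpsX rat).

Lemma gf_dyckE h : gf 0 h =
  (h == 0%N)%:R + x * (gf 0 h.+1 + (if h is h'.+1 then gf 0 h' else 0)).
Proof.
apply: fpsP => -[|n]; rewrite coef_fpsD ?coef_fpsXM0 ?coef_fpsXMS.
  by case: h => [|h] /=; rewrite ?addr0.
rewrite coef_fpsD /= cats0 size_cat size_map natrD.
by case: h => [|h] /=; rewrite ?size_map ?if_same ?add0r.
Qed.

(** A catastrophe needs height at least 2 and leaves a Dyck path from the axis, hence the term
    [x * gf 0 0]. *)
Lemma gf_catE h : gf 1 h = (if (1 < h)%N then x * gf 0 0 else 0)
  + x * (gf 1 h.+1 + (if h is h'.+1 then gf 1 h' else 0)).
Proof.
apply: fpsP => -[|n]; rewrite coef_fpsD ?coef_fpsXM0 ?coef_fpsXMS.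
  by case: h => [|[|h]]; rewrite addr0 ?coef_fps0 ?coef_fpsXM0.
rewrite coef_fpsD [LHS]/= !size_cat size_map !natrD addrA addrC; congr (_ + _).
  by case: h => [|[|h]]; rewrite ?coef_fps0 ?coef_fpsXMS ?size_map.
by case: h => [|h]; rewrite ?coef_fps0 ?size_map.
Qed.

Section ClosedForms.
Variable d : fps rat.
Hypothesis dE : d = 1 + x ^+ 2 * d ^+ 2.

(** Reduces an equality modulo the Dyck equation to a polynomial identity for [ring], once the
    cofactor [k] is supplied. *)
Lemma eq_mod_dyck (k u v : fps rat) :
  u - v = k * (d - (1 + x ^+ 2 * d ^+ 2)) -> u = v.
Proof. by rewrite -dE subrr mulr0 => /subr0_eq. Qed.

Lemma gf_dyck h : gf 0 h = x ^+ h * d ^+ h.+1.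
Proof.
apply: (@first_step_eq_uniq _ _ _ (fun h => x ^+ h * d ^+ h.+1) gf_dyckE) h.
move=> -[|h] /=.
  by apply: (eq_mod_dyck (k := 1)); ring.
apply: (eq_mod_dyck (k := x ^+ h.+1 * d ^+ h.+1)).
by rewrite add0r !exprS; ring.
Qed.

(* For h > 1 the recurrence has the constant particular solution
   x d / (1 - 2 x), to which a multiple of the homogeneous solution (x d) ^ h
   is added; the boundary equation at h = 0 fixes that multiple. *)
Lemma gf_cat h : (1 - 2 * x) * gf 1 h =
  x * d - d ^+ 2 * (1 - x - x ^+ 2) * (x * d) ^+ h
  + (h == 0%N)%:R * ((1 - 2 * x) * d).
Proof.
pose c h := if (1 < h)%N then (1 - 2 * x) * (x * d) else 0.
pose k h : fps rat := x * d - d ^+ 2 * (1 - x - x ^+ 2) * (x * d) ^+ h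
  + (h == 0%N)%:R * ((1 - 2 * x) * d).
apply: (@first_step_eq_uniq _ c (fun h => (1 - 2 * x) * gf 1 h) k) h => h /=.
  by rewrite gf_catE gf_dyck /c; case: h => [|[|h]] /=; ring.
rewrite /c /k; case: h => [|[|h]] /=.
- apply: (eq_mod_dyck (k := - d * (1 - x - x ^+ 2))); ring.
- apply: (eq_mod_dyck (k := - x * d ^+ 2 * (1 - x - x ^+ 2))); ring.
apply: (eq_mod_dyck
  (k := - x * d ^+ 2 * (1 - x - x ^+ 2) * (x * d) ^+ h.+1)).
rewrite !exprS; ring.
Qed.

(** This is the target formula, cross-multiplied, after putting [s = 1 - 2 x^2 d] and cancelling
    [4 x^4]. The factor [1 - 2 * x] from [gf_cat] is nonzero, having constant term 1, and can be
    cancelled. *)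
Lemma gf_pathB :
  x * (1 - x * d) * ogf size pathB = d * (x - 1 + d - 2 * x ^+ 2 * d).
Proof.
have nz : 1 - 2 * x != 0 :> fps rat.
  apply/eqP => /(congr1 (fun f => f``_0)).
  by rewrite mulrC coef_fpsD coef_fpsN coef_fpsXM0 subr0 coef_fps0.
apply: (mulfI nz); rewrite ogf_pathB gf_dyck.
have := gf_cat 0; rewrite expr0 eqxx mulr1 mul1r => catE.
rewrite mulrCA [(1 - _) * (_ + gf 1 0)]mulrDr catE.
by apply: (eq_mod_dyck (k := - d * (1 - x - x ^+ 2))); ring.
Qed.

End ClosedForms.

(** With [s] the square root, [d] is [(1 - s) / (2 x^2)], a power series because [s] has
    coefficients 1 and 0 in degrees 0 and 1. *)
Lemma sqrt_dyck : exists d : fps rat,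
  d = 1 + x ^+ 2 * d ^+ 2 /\ fps_sqrt (1 - 4 * x ^+ 2) = 1 - 2 * x ^+ 2 * d.
Proof.
have := @fps_sqrtK rat (1 - 4 * x ^+ 2) isT.
have := fps_sqrtS (1 - 4 * x ^+ 2) 0; rewrite big_geq //.
have := fps_sqrt0 (1 - 4 * x ^+ 2).
have f1 : (1 - 4 * x ^+ 2)``_1 = 0.
  rewrite expr2 mulrCA coef_fpsD coef_fpsN coef_fpsXMS mulrC coef_fpsXM0.
  by rewrite subr0.
have f0 : (1 - 4 * x ^+ 2)``_0 = 1.
  by rewrite expr2 mulrCA coef_fpsD coef_fpsN coef_fpsXM0 subr0.
rewrite f1 f0 subr0 mul0r => s0 s1 /(_ erefl).
move: (fps_sqrt _) s0 s1 => s s0 s1 s2.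
have [|d dE] := @fps_divXn _ (FPS (fun n => (1 - s)``_n / 2)) 2.
  by case=> [|[|//]] _ /=; rewrite ?s0 ?s1 ?subrr ?subr0 mul0r.
have sE : s = 1 - 2 * x ^+ 2 * d.
  apply: fpsP => n; rewrite -mulrA -dE mulr_natl coef_fpsD coef_fpsN coef_fpsMn.
  rewrite -[X in X *+ 2]/((1 - s)``_n / 2) -[_ *+ 2]mulr_natr divfK //.
  by rewrite coef_fpsD coef_fpsN subKr.
exists d; split=> //.
have nz : 4 * x ^+ 2 != 0 :> fps rat.
  apply/eqP => /(congr1 (fun f => f``_2)).
  by rewrite mulr_natl coef_fpsMn coef_fpsXn coef_fps0.
apply: (mulfI nz); apply/eqP; rewrite -subr_eq0; apply/eqP.
(* Multiplied by [4 x^2], the Dyck equation becomes [s^2 = 1 - 4 x^2]. *)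
transitivity (1 - 4 * x ^+ 2 - s ^+ 2); first by rewrite sE; ring.
by rewrite s2 subrr.
Qed.

End GeneratingFunctions.

(** * The formula for [B] and its first coefficients *)

Lemma coef_gf_pathB n :
  (gf 0 0 + gf 1 0)``_n = (size (paths n 0 0) + size (paths n 1 0))%:R.
Proof. by rewrite coef_fpsD natrD. Qed.

Theorem theorem2p4 :
  let x := fpsX rat in
  let s := fps_sqrt (1 - 4 * x ^+ 2) in
  let B := ogf size pathB in
  B%:F =
    ((1 - s) * (2 * x ^+ 3 - 4 * x ^+ 2 + 1 + (2 * x ^+ 2 - 1) * s))%:F
      / (2 * x ^+ 4 * (2 * x - 1 + s))%:F
      :> {fraction fps rat}
  /\ fps_eqO 12 B
       (1 + x ^+ 2 + x ^+ 3 + 3 * x ^+ 4 + 5 * x ^+ 5 + 11 * x ^+ 6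
          + 21 * x ^+ 7 + 42 * x ^+ 8 + 84 * x ^+ 9 + 162 * x ^+ 10
          + 330 * x ^+ 11).
Proof.
move=> x s B; split; last first.
  move=> n n12; rewrite /B ogf_pathB coef_gf_pathB 8!coef_fpsD_natMXn.
  rewrite 2!coef_fpsD coef_fps1 !coef_fpsXn -!natrD; congr _%:R.
  (* The twelve coefficients are counted directly on the lists [paths], without the closed form. *)
  by do 12?[case: n n12 => [|n] n12; first by vm_compute].
have [d [dE sE]] := sqrt_dyck; rewrite -/x -/s in dE sE.
have := gf_pathB dE; rewrite -/x -/B => BE.
(* In terms of [d] the denominator is [4 x^5 (1 - x d)], and [1 - x d] has constant term 1. *)
have nz : 2 * x ^+ 4 * (2 * x - 1 + s) != 0.
  have -> : 2 * x ^+ 4 * (2 * x - 1 + s) = x ^+ 5 * ((1 - x * d) *+ 4).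
    by rewrite sE; ring.
  rewrite mulf_eq0 expf_eq0 /= negb_or; apply/andP; split.
    by apply/eqP => /(congr1 (fun f => f``_1)); rewrite coef_fps0.
  apply/eqP => /(congr1 (fun f => f``_0)).
  by rewrite coef_fpsMn coef_fpsD coef_fpsN coef_fpsXM0 coef_fps0.
apply: (canRL (mulfK _)); first by rewrite tofrac_eq0.
rewrite -tofracM; congr _%:F.
(* Both sides carry the factor [4 x^4]; what remains is [gf_pathB]. *)
transitivity (4 * x ^+ 4 * (x * (1 - x * d) * B)); first by rewrite sE; ring.
by rewrite BE sE; ring.
Qed.
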